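(* Let $r\ge 2$ and $\ell\ge r+1$ be integers, and let $F=K_{a_1,\ldots,a_r}$ be an almost balanced complete $r$-partite graph on $\ell=a_1+\cdots+a_r$ vertices. Let $m=m_{r,\ell}$. Then for every integer $k\ge r$, \[ i_{k+1}(F)=\begin{cases}\kappa_F\cdot\frac{(k-1)_{r-1}}{k^{\ell-1}}, & \text{if } k\in[r,m-1],\\[.3em] \kappa_F\cdot\frac{(m-1)_{r-1}}{m^{\ell-1}}, & \text{if } k\ge m.\end{cases} \]
   Context: For graphs $F,G$, $I(F,G)$ denotes the number of induced copies of $F$ in $G$ (subsets $S\subseteq V(G)$ with $|S|=v(F)$ and $G[S]\cong F$). For an integer $k\ge 1$, $I_{k+1}(F,n)$ is the maximum of $I(F,G)$ over all $n$-vertex graphs $G$ containing no (not necessarily induced) copy of the complete graph $K_{k+1}$, and $i_{k+1}(F)=\lim_{n\to\infty}I_{k+1}(F,n)/\binom{n}{v(F)}$. $K_{a_1,\ldots,a_r}$ denotes the complete $r$-partite graph with part sizes $a_1\ge\cdots\ge a_r\ge 1$; it is almost balanced if it is not a complete graph and $\binom{a_1-a_r}{2}<a_r$. For an integer $z$ and positive integer $k$, $(z)_k=z(z-1)\cdots(z-k+1)$ if $z>k-1$ and $(z)_k=0$ otherwise. $\kappa_F=\frac{\ell!}{a_1!\cdots a_r!\cdot \mathrm{sym}(a_1,\ldots,a_r)}$, where $\mathrm{sym}(a_1,\ldots,a_r)=r_1!\cdots r_t!$ if the distinct values among $a_1,\ldots,a_r$ occur with multiplicities $r_1,\ldots,r_t$.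 $m_{r,\ell}$ is the unique integer $k\ge r$ maximizing $f(k)=\frac{(k-1)(k-2)\cdots(k-r+1)}{k^{\ell-1}}$ over all integers $k\ge r$. *)

(* Defs.v *)
From HB Require Import structures.
From mathcomp Require Import all_boot all_order all_algebra.
From mathcomp Require Import all_classical all_reals all_analysis.
Set Implicit Arguments. Unset Strict Implicit. Unset Printing Implicit Defensive.
Import Order.TTheory GRing.Theory Num.Theory.

Definition graph (n : nat) := {ffun 'I_n * 'I_n -> bool}.

Definition is_simple n (G : graph n) : bool :=
  [forall x : 'I_n, ~~ G (x, x)] && [forall x : 'I_n, forall y : 'I_n, G (x, y) == G (y, x)].

Definition has_clique n (G : graph n) (s : nat) : bool :=
  [exists C : {set 'I_n}, (#|C| == s) &&
     [forall x in C, forall y in C, (x != y) ==> G (x, y)]].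

Notation Kpart_vert r a := {i : 'I_r & 'I_(a i)}.
Definition Kpart_edge (r : nat) (a : nat -> nat) (x y : Kpart_vert r a) : bool :=
  tag x != tag y.

Definition induced_copy n (r : nat) (a : nat -> nat) (G : graph n) (S : {set 'I_n}) : bool :=
  [exists f : {ffun Kpart_vert r a -> 'I_n},
     [&& injectiveb f, S == [set f x | x : Kpart_vert r a] &
         [forall x, forall y, Kpart_edge x y == G (f x, f y)]]].

Definition Icount n r a (G : graph n) : nat :=
  #|[set S : {set 'I_n} | induced_copy r a G S]|.

Definition Imax (r : nat) (a : nat -> nat) (k n : nat) : nat :=
  \max_(G : graph n | is_simple G && ~~ has_clique G k.+1) Icount r a G.

Definition nverts (r : nat) (a : nat -> nat) : nat := \sum_(i < r) a i.

Definition is_complete_graph (r : nat) (a : nat -> nat) : bool :=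
  [forall x : Kpart_vert r a, forall y : Kpart_vert r a, (x != y) ==> Kpart_edge x y].

(* almost balanced, with parts a 0 >= ... >= a (r-1) *)
Definition almost_balanced (r : nat) (a : nat -> nat) : bool :=
  ~~ is_complete_graph r a && ('C(a 0 - a r.-1, 2) < a r.-1).

Definition symf (r : nat) (a : nat -> nat) : nat :=
  \prod_(v <- undup [seq a i | i <- iota 0 r]) (count (fun i => a i == v) (iota 0 r))`!.

Definition kappa {R : realType} (r : nat) (a : nat -> nat) : R :=
  ((nverts r a)`!)%:R / ((\prod_(i < r) (a i)`!) * symf r a)%:R.

Definition fval {R : realType} (r ell k : nat) : R :=
  ((k.-1) ^_ (r.-1))%:R / (k ^ (ell.-1))%:R.

(* Main.v *)
(* Write [V] for the vertex set of [F]. For a probability weight [w] on the vertices of [G], the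
   density of [F] is [t(w)], the sum over the strong homomorphisms [f : V -> G] (edges and non-edges
   both preserved) of the product of the [w (f x)]; at the uniform weight it bounds the number of
   induced copies.  As in the Motzkin-Straus argument, take a maximizer of [t] on the simplex with
   the smallest support.  If [u] and [v] are non-adjacent, moving their joint mass to one of them
   does not decrease [t], because in a homomorphism hitting both they are twins; hence the support
   is a clique, on at most [k] vertices.  On a clique, two weights [h (1 + t)] and [h (1 - t)]
   satisfy P <= (1 - t^2) P(h, h) + t^2 P(2h, 0), where almost balancedness is exactly what is
   needed for the monomials containing both vertices.  So the weights are equal, and the maximum is
   [j (j-1) ... (j-r+1) / j^l] for some [j <= k], i.e. [fval r l j], which increases up to [j = m].
   Turan graphs give the matching lower bound. *)
Require Import Defs.
From HB Require Import structures.
From mathcomp Require Import all_boot all_order all_algebra all_fingroup.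
From mathcomp Require Import all_classical all_reals all_analysis.
From mathcomp Require Import ring lra.
Import Order.TTheory GRing.Theory Num.Theory numFieldNormedType.Exports.
Local Open Scope ring_scope.
Set Implicit Arguments.
Unset Strict Implicit.

(** * Chord inequalities *)

(** The right-hand sides are chords over [0, 1], in [t ^+ 2] for the sum S and in [t] for the
    difference D. They are proved together because S' = S + t D and D' = D + t S when the exponent
    grows by one. *)
Lemma pow_sum_chord (R : realFieldType) (t : R) (p : nat) : 0 <= t <= 1 ->
  (1 + t) ^+ p.+1 + (1 - t) ^+ p.+1 <= 2 * (1 - t ^+ 2) + t ^+ 2 * 2 ^+ p.+1 /\
  (1 + t) ^+ p.+1 - (1 - t) ^+ p.+1 <= t * 2 ^+ p.+1.
Proof.
move=> /andP[t0 t1]; elim: p => [|p [IHs IHd]]; first by rewrite !expr1; split; lra.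
have tD := ler_wpM2l t0 IHd; have tS := ler_wpM2l t0 IHs.
have p2 : (1 : R) <= 2 ^+ p.
  by rewrite exprn_ege1 // ler1n.
rewrite !(exprS _ p.+1); move: IHs IHd tD tS; rewrite [2 ^+ p.+1]exprS.
move: ((1 + t) ^+ p.+1) ((1 - t) ^+ p.+1) (2 ^+ p) p2 => x y z z1 IHs IHd tD tS.
split; first nra.
have tt : 0 <= 1 - t ^+ 2 by nra.
have := mulr_ge0 (mulr_ge0 t0 tt) (_ : 0 <= z - 1); rewrite subr_ge0 => /(_ z1).
nra.
Qed.

(** The same recursion. Passing from [d] to [d + 1] multiplies the bound on the sum by 1 + d t^2,
    which Bernoulli's inequality bounds by (1 + t^2)^d; this is why the exponent is a binomial. *)
Lemma pow_sum_le_expr (R : realFieldType) (t : R) (d : nat) : 0 <= t <= 1 ->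
  (1 + t) ^+ d + (1 - t) ^+ d <= 2 * (1 + t ^+ 2) ^+ 'C(d, 2) /\
  (1 + t) ^+ d - (1 - t) ^+ d <= 2 * d%:R * t * (1 + t ^+ 2) ^+ 'C(d, 2).
Proof.
move=> /andP[t0 t1]; have tt : 0 <= t ^+ 2 by rewrite sqr_ge0.
elim: d => [|d [IHs IHd]]; first by rewrite !expr0; split; lra.
have tD := ler_wpM2l t0 IHd; have tS := ler_wpM2l t0 IHs.
have e1 : (1 : R) <= (1 + t ^+ 2) ^+ d by rewrite exprn_ege1 // lerDl.
have bern : 1 + d%:R * t ^+ 2 <= (1 + t ^+ 2) ^+ d.
  elim: d {IHs IHd tD tS e1} => [|d IH]; first by rewrite expr0; lra.
  have d0 : 0 <= d%:R :> R by [].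
  have u0 : 0 <= 1 + t ^+ 2 by rewrite addr_ge0.
  rewrite (exprS _ d) -(natr1 d); have := ler_wpM2l u0 IH.
  have := mulr_ge0 d0 (mulr_ge0 tt tt); lra.
rewrite !(exprS _ d) binS bin1 exprD -(natr1 d).
have c0 : 0 <= (1 + t ^+ 2) ^+ 'C(d, 2) by rewrite exprn_ge0 // addr_ge0.
have := ler_wpM2l c0 bern; have := ler_wpM2l c0 e1.
have d0 : 0 <= d%:R :> R by [].
move: IHs IHd tD tS c0.
move: ((1 + t) ^+ d) ((1 - t) ^+ d) ((1 + t ^+ 2) ^+ 'C(d, 2)) ((1 + t ^+ 2) ^+ d) (d%:R) d0.
move=> x y C E D D0 IHs IHd tD tS c0 h1 h2.
split; first nra.
have := ler_wpM2l (mulr_ge0 D0 t0) h1; have := ler_wpM2l t0 h1.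
lra.
Qed.

(* Each of the at most [b - 1] factors [1 + t^2] is absorbed by a factor [1 - t^2]. *)
Lemma balanced_pow_le (R : realFieldType) (t : R) (d b : nat) : 0 <= t <= 1 ->
  ('C(d, 2) < b)%N ->
  (1 - t ^+ 2) ^+ b * ((1 + t) ^+ d + (1 - t) ^+ d) <= 2 * (1 - t ^+ 2).
Proof.
move=> t01; case: b => // b; rewrite ltnS => Cb.
have [S_le _] := pow_sum_le_expr d t01; case/andP: t01 => t0 t1.
have u0 : 0 <= 1 - t ^+ 2 by nra.
have v0 : 0 <= t ^+ 2 by rewrite sqr_ge0.
have u1 : 1 - t ^+ 2 <= 1 by lra.
have ub : (1 - t ^+ 2) ^+ b <= (1 - t ^+ 2) ^+ 'C(d, 2) by rewrite ler_wiXn2l.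
have uv : (1 - t ^+ 2) ^+ 'C(d, 2) * (1 + t ^+ 2) ^+ 'C(d, 2) <= 1.
  by rewrite -exprMn exprn_ile1 //; nra.
have b0 : 0 <= (1 - t ^+ 2) ^+ b by rewrite exprn_ge0.
have c0 : 0 <= (1 + t ^+ 2) ^+ 'C(d, 2) by rewrite exprn_ge0 // addr_ge0.
have h1 := ler_wpM2l b0 S_le; have h2 := ler_wpM2r c0 ub.
rewrite (exprS _ b) -mulrA [leRHS]mulrC; apply: ler_wpM2l => //.
lra.
Qed.

(** Taking out (x y)^q = h^(2q) (1 - t^2)^q leaves the powers with exponent d = p - q treated by
    [balanced_pow_le]. *)
Lemma balanced_swap_le (R : realFieldType) (h t : R) (p q : nat) :
  0 <= h -> 0 <= t <= 1 -> (q <= p)%N -> ('C(p - q, 2) < q)%N ->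
  let x := h * (1 + t) in let y := h * (1 - t) in
  x ^+ p * y ^+ q + y ^+ p * x ^+ q <= (1 - t ^+ 2) * (2 * h ^+ (p + q)).
Proof.
move=> h0 t01 /subnK <- /=; rewrite addnK; move: (p - q)%N => d /(balanced_pow_le t01) H.
rewrite !exprMn !exprD.
have hh : 0 <= h ^+ d * h ^+ q * h ^+ q by rewrite !mulr_ge0 ?exprn_ge0.
have := ler_wpM2l hh H.
have -> : (1 - t ^+ 2) ^+ q = (1 + t) ^+ q * (1 - t) ^+ q by rewrite -exprMn; congr (_ ^+ _); ring.
lra.
Qed.

(* [p] and [q] are the exponents of the two variables in a monomial; the right-hand side
   interpolates between the averaged point [(h, h)] and the merged point [(2 h, 0)]. *)
Lemma swap_chord (R : realFieldType) (h t : R) (p q : nat) :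
  0 <= h -> 0 <= t <= 1 ->
  ((0 < p)%N -> (0 < q)%N -> ('C(maxn p q - minn p q, 2) < minn p q)%N) ->
  let x := h * (1 + t) in let y := h * (1 - t) in
  x ^+ p * y ^+ q + y ^+ p * x ^+ q <=
    (1 - t ^+ 2) * (h ^+ p * h ^+ q + h ^+ p * h ^+ q) +
    t ^+ 2 * ((2 * h) ^+ p * 0 ^+ q + 0 ^+ p * (2 * h) ^+ q).
Proof.
move=> h0 t01 /= C_lt.
wlog qp : p q C_lt / (q <= p)%N.
  move=> W; case: (leqP q p) => [|/ltnW] qp; first exact: W.
  have := W q p; rewrite maxnC minnC => /(_ (fun a b => C_lt b a) qp).
  by rewrite [X in X <= _ -> _]addrC [X in _ <= _ + _ * X -> _]addrC
    ![_ * (h * (1 + t)) ^+ p]mulrC ![_ * (h * (1 - t)) ^+ p]mulrC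
    ![_ * (2 * h) ^+ p]mulrC ![_ * 0 ^+ p]mulrC (mulrC (h ^+ p)).
case: p qp C_lt => [|p].
  by rewrite leqn0 => /eqP -> _; rewrite !expr0; lra.
(* If q = 0, only one variable occurs and the chord in t^2 suffices. If both exponents are positive,
   the merged point contributes 0, so the averaged term alone must dominate. *)
case: q => [_ _|q qp C_lt].
  have [H _] := pow_sum_chord p t01.
  rewrite !expr0 !expr0n /= !mulr1 !exprMn.
  have := ler_wpM2l (exprn_ge0 p.+1 h0) H; lra.
have := balanced_swap_le h0 t01 qp.
move: (C_lt isT isT); rewrite (maxn_idPl qp) (minn_idPr qp) => Cb /(_ Cb) /= H.
rewrite !expr0n /=; move: H; rewrite [h ^+ (_ + _)]exprD; lra.
Qed.

(** Convexity of the power between 1 and [z]. The gap in the induction step is exactly l (1 - l) (1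
    - z) (1 - z^n). *)
Lemma expr_chord (R : realFieldType) (l z : R) (n : nat) : 0 <= l <= 1 -> 0 <= z <= 1 ->
  (1 - l + l * z) ^+ n <= 1 - l + l * z ^+ n.
Proof.
move=> /andP[l0 l1] /andP[z0 z1]; elim: n => [|n IH]; first by rewrite !expr0; lra.
have c0 : 0 <= 1 - l + l * z by nra.
rewrite !exprS; have := ler_wpM2l c0 IH.
have y0 : 0 <= z ^+ n by rewrite exprn_ge0.
have y1 : z ^+ n <= 1 by rewrite exprn_ile1.
move: ((1 - l + l * z) ^+ n) (z ^+ n) y0 y1 => a y y0 y1 H.
have l2 : 0 <= l * (1 - l) by nra.
have z2 : 0 <= (1 - z) * (1 - y) by nra.
have := mulr_ge0 l2 z2; nra.
Qed.

(** * Weighted homomorphism density *)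

(** Maps need not be injective: in a loopless graph a whole part may land on one vertex, which is
    what lets cliques carry the maximum. *)
Definition strong n (r : nat) (a : nat -> nat) (G : graph n)
    (f : {ffun Kpart_vert r a -> 'I_n}) : bool :=
  [forall x, forall y, Kpart_edge x y == G (f x, f y)].

Definition hom_weight {R : realType} n (r : nat) (a : nat -> nat) (G : graph n)
    (w : 'I_n -> R) : R :=
  \sum_(f | @strong n r a G f) \prod_x w (f x).

Definition set2 {R : realType} n (w : 'I_n -> R) (u v : 'I_n) (x y : R) : 'I_n -> R :=
  fun i => if i == u then x else if i == v then y else w i.

Lemma strongP n r (a : nat -> nat) (G : graph n) (f : {ffun Kpart_vert r a -> 'I_n}) :
  reflect (forall x y, Kpart_edge x y = G (f x, f y)) (strong G f).
Proof.
apply: (iffP forallP) => [H x y|H x]; first by move/forallP: (H x) => /(_ y)/eqP.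
by apply/forallP => y; apply/eqP/H.
Qed.

Lemma simple_irr n (G : graph n) : is_simple G -> forall x, G (x, x) = false.
Proof. by move=> /andP[/forallP H _] x; apply/negbTE. Qed.

Lemma simple_sym n (G : graph n) : is_simple G -> forall x y, G (x, y) = G (y, x).
Proof. by move=> /andP[_ /forallP H] x y; apply/eqP; move/forallP: (H x). Qed.

Lemma Kpart_edgeC r (a : nat -> nat) (x y : Kpart_vert r a) : Kpart_edge x y = Kpart_edge y x.
Proof. by rewrite /Kpart_edge eq_sym. Qed.

(* All vertices sent to [u] or [v] lie in one part, hence are twins. *)
Lemma strong_merge n r (a : nat -> nat) (G : graph n) (u v z : 'I_n)
    (f f' : {ffun Kpart_vert r a -> 'I_n}) x1 x2 :
  is_simple G -> ~~ G (u, v) -> strong G f -> f x1 = u -> f x2 = v -> z \in [:: u; v] ->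
  (forall x, f' x = if f x \in [:: u; v] then z else f x) -> strong G f'.
Proof.
move=> sG Guv /strongP fS fx1 fx2 zuv f'E.
have irr := simple_irr sG; have sym := simple_sym sG.
have X1 x : f x \in [:: u; v] -> tag x = tag x1.
  have E12 : tag x1 = tag x2.
    by apply/eqP/negPn; rewrite -/(Kpart_edge x1 x2) fS fx1 fx2.
  rewrite !inE => /orP[] /eqP fx; first rewrite E12;
    by apply/eqP/negPn; rewrite -/(Kpart_edge _ _) fS fx ?fx1 ?fx2 // sym.
have [xz fxz] : exists x, f x = z.
  by move: zuv; rewrite !inE => /orP[] /eqP ->; [exists x1 | exists x2].
have key x y : f x \in [:: u; v] -> f y \notin [:: u; v] -> Kpart_edge x y = G (z, f y).
  move=> xX yX; rewrite -fxz -fS /Kpart_edge (X1 x) // (X1 xz) //.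
  by rewrite fxz.
apply/strongP => x y; rewrite !f'E.
have [xX|xX] := boolP (f x \in _); have [yX|yX] := boolP (f y \in _).
- by rewrite irr /Kpart_edge (X1 x) // (X1 y) // eqxx.
- exact: key.
- by rewrite sym Kpart_edgeC; exact: key.
- exact: fS.
Qed.

(** Once [x0] is isolated, both sides carry the factor [w u * w1 u] and the remaining factors
    compare one by one. This handles a fibre with a single strong map. *)
Lemma prod_chord (R : realType) (T : finType) n (w w1 : 'I_n -> R) (g : T -> 'I_n) u x0 :
  (forall i, 0 <= w i) -> (forall x, w (g x) <= w1 (g x)) -> g x0 = u ->
  w1 u * \prod_x w (g x) <= w u * \prod_x w1 (g x).
Proof.
move=> w0 ww gx0.
rewrite (bigD1 x0) //= [in leRHS](bigD1 x0) //= gx0 mulrCA ler_wpM2l // ler_wpM2l //.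
  by rewrite -gx0 (le_trans (w0 _) (ww x0)).
by apply: ler_prod => x _; rewrite w0 ww.
Qed.

(* The homomorphisms are grouped by their image [g] under the collapse [v |-> u]; a fibre contains
   a map other than [g] and its swap only if both of these are strong, and then its total weight
   is at most that of the whole fibre. *)
Lemma nonadjacent_chord (R : realType) n r (a : nat -> nat) (G : graph n) (w : 'I_n -> R) (u v : 'I_n) :
  is_simple G -> (forall i, 0 <= w i) -> u != v -> ~~ G (u, v) ->
  (w u + w v) * hom_weight r a G w <=
    w u * hom_weight r a G (set2 w u v (w u + w v) 0) +
    w v * hom_weight r a G (set2 w u v 0 (w u + w v)).
Proof.
move=> sG w0 uv Guv; set c := w u + w v; set w1 := set2 w u v c 0; set w2 := set2 w u v 0 c.
pose coll z := if z == v then u else z.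
pose collf (f : {ffun Kpart_vert r a -> 'I_n}) := [ffun x => coll (f x)].
pose tauf (f : {ffun Kpart_vert r a -> 'I_n}) := [ffun x => tperm u v (f x)].
have tauK : involutive tauf by move=> f; apply/ffunP => x; rewrite !ffunE tpermK.
have vu : v == u = false by rewrite eq_sym (negbTE uv).
have c0 : 0 <= c by rewrite addr_ge0.
have w1u : w1 u = c by rewrite /w1 /set2 eqxx.
have w1v : w1 v = 0 by rewrite /w1 /set2 vu eqxx.
have w1_ge0 i : 0 <= w1 i by rewrite /w1 /set2; case: ifP => // _; case: ifP.
have w2tau z : w2 (tperm u v z) = w1 z.
  rewrite /w1 /w2 /set2; case: tpermP => [->|->|/eqP zu /eqP zv].
  - by rewrite vu !eqxx.
  - by rewrite vu !eqxx.
  - by rewrite (negbTE zu) (negbTE zv).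
have w1_out z : z != u -> z != v -> w1 z = w z.
  by move=> zu zv; rewrite /w1 /set2 (negbTE zu) (negbTE zv).
rewrite /hom_weight (partition_big collf xpredT) //=.
(* [w2] is [w1] with [u] and [v] swapped, so reindexing by [tauf] makes both right-hand sums run
   over the same products. *)
rewrite [X in _ <= _ + _ * X](reindex_inj (inv_inj tauK)) /=.
rewrite [X in _ <= _ + _ * X](eq_bigr (fun g : {ffun _} => \prod_x w1 (g x))); last first.
  by move=> g _; apply: eq_bigr => x _; rewrite ffunE w2tau.
rewrite [X in _ <= _ * X + _]big_mkcond [X in _ <= _ + _ * X]big_mkcond /=.
rewrite !mulr_sumr -big_split /=; apply: ler_sum => g _.
set Q := \prod_x w1 (g x); have Q0 : 0 <= Q by apply: prodr_ge0.
have [/existsP[xv /eqP gxv]|/existsPn gv] := boolP [exists x, g x == v].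
  rewrite big_pred0 => [|f]; last first.
    apply/negP => /andP[_ /eqP fg]; move: gxv; rewrite -fg ffunE /coll.
    by case: eqP => [_ /eqP|fv //]; rewrite (negbTE uv).
  by rewrite mulr0 addr_ge0 ?mulr_ge0 //; case: ifP.
have fib f x : collf f = g -> f x \in [:: u; v] = (g x == u).
  move=> <-; rewrite ffunE /coll !inE; case: (f x =P v) => [->|_]; first by rewrite eqxx orbT.
  by rewrite orbF.
have fib_out f x : collf f = g -> g x != u -> f x = g x.
  move=> fg; rewrite -(fib f) // !inE negb_or => /andP[_ fv].
  by rewrite -fg ffunE /coll (negbTE fv).
(* Without the strongness condition the fibre sum factors over the vertices of F, and each vertex
   sent to [u] contributes [w u + w v]. *)
have sum_fib : \sum_(f | collf f == g) \prod_x w (f x) = Q.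
  rewrite /Q (eq_bigr (fun x => \sum_(z | coll z == g x) w z)); last first.
    move=> x _; have [gu|gu] := eqVneq (g x) u.
      rewrite gu w1u (bigD1 u) /=; last by rewrite /coll (negbTE uv).
      rewrite (bigD1 v) /=; last by rewrite /coll eqxx eqxx vu.
      rewrite big_pred0 ?addr0 // => z; rewrite /coll; case: (z =P v) => //= _.
        by rewrite !andbF.
      by rewrite andbT andbN.
    rewrite w1_out // (big_pred1 (g x)) // => z /=; rewrite /coll; case: (z =P v) => // ->.
    by rewrite eq_sym (negbTE gu) eq_sym (negbTE (gv x)).
  rewrite bigA_distr_big_dep; apply: eq_bigl => f.
  apply/eqP/familyP => [<- x|H]; first by rewrite unfold_in ffunE.
  by apply/ffunP => x; have := H x; rewrite unfold_in ffunE => /eqP.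
have mixed f x1 x2 : strong G f -> collf f = g -> f x1 = u -> f x2 = v ->
    strong G g /\ strong G (tauf g).
  move=> fS fg fx1 fx2; split.
    apply: (strong_merge (z := u) sG Guv fS fx1 fx2); first by rewrite !inE eqxx.
    by move=> x; rewrite fib //; case: eqP => // /eqP H; rewrite (fib_out f).
  apply: (strong_merge (z := v) sG Guv fS fx1 fx2); first by rewrite !inE eqxx orbT.
  move=> x; rewrite fib // ffunE; case: eqP => [->|/eqP H]; first by rewrite tpermL.
  by rewrite (fib_out f) // tpermD // eq_sym.
have [both|] := boolP (strong G g && strong G (tauf g)).
  have /andP[-> ->] := both.
  rewrite -mulrDl ler_wpM2l // -sum_fib big_andbC.
  rewrite [leRHS](bigID (strong G)) /= lerDl.
  by apply: sumr_ge0 => f _; apply: prodr_ge0.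
move=> nboth.
(* A map hitting both [u] and [v] would make [g] and [tauf g] both strong, so only these two can be
   strong in the fibre. *)
have pure f : strong G f -> collf f = g -> f = g \/ f = tauf g.
  move=> fS fg.
  have [/existsP[x1 /eqP fx1]|/existsPn nu] := boolP [exists x, f x == u].
    have [/existsP[x2 /eqP fx2]|/existsPn nv] := boolP [exists x, f x == v].
      by case: (mixed f x1 x2 fS fg fx1 fx2) => g1 g2; rewrite g1 g2 in nboth.
    by left; rewrite -fg; apply/ffunP => x; rewrite ffunE /coll (negbTE (nv x)).
  right; rewrite -fg; apply/ffunP => x; rewrite !ffunE /coll.
  case: (f x =P v) => [->|/eqP fv]; first by rewrite tpermL.
  by rewrite tpermD // eq_sym ?nu.
(* A [g] avoiding [u] is its own swap. So when exactly one of [g] and [tauf g] is strong, some [x0]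
   is sent to [u], as [prod_chord] requires. *)
have no_fib : ~~ [exists x, g x == u] -> tauf g = g.
  move=> /existsPn gu; apply/ffunP => x.
  by rewrite ffunE tpermD // eq_sym ?gu ?gv.
have [gS|gS] := boolP (strong G g).
  have tS : strong G (tauf g) = false by apply/negbTE; move: nboth; rewrite gS.
  rewrite tS mulr0 addr0.
  have /existsP[x0 /eqP gx0] : [exists x, g x == u].
    by apply: contraFT tS => /no_fib ->.
  rewrite (big_pred1 g) => [|f /=].
    rewrite -w1u; apply: prod_chord gx0 => // x.
    have [->|gu] := eqVneq (g x) u; last by rewrite w1_out.
    by rewrite w1u lerDl.
  apply/andP/eqP => [[fS /eqP fg]|->].
    by case: (pure f fS fg) => // ft; move: fS; rewrite ft tS.
  split=> //; apply/eqP/ffunP => x; rewrite ffunE /coll (negbTE (gv x)) //.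
rewrite mulr0 add0r.
have [tS|tS] := boolP (strong G (tauf g)); last first.
  rewrite big_pred0 ?mulr0 // => f; apply/negP => /andP[fS /eqP fg].
  by case: (pure f fS fg) => ft; move: fS; rewrite ft ?(negbTE gS) ?(negbTE tS).
have /existsP[x0 /eqP gx0] : [exists x, g x == u].
  by apply: contraNT gS => /no_fib <-.
rewrite (big_pred1 (tauf g)) => [|f /=].
  under eq_bigr do rewrite ffunE.
  have := @prod_chord R _ n (fun z => w (tperm u v z)) w1 g u x0 _ _ gx0.
  rewrite /= tpermL w1u; apply=> // x.
  have [->|gu] := eqVneq (g x) u; first by rewrite tpermL w1u lerDr.
  by rewrite w1_out // tpermD // eq_sym.
apply/andP/eqP => [[fS /eqP fg]|->].
  by case: (pure f fS fg) => // ft; move: fS; rewrite ft (negbTE gS).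
split=> //; apply/eqP/ffunP => x; rewrite !ffunE /coll.
case: tpermP => [->|H|/eqP gu /eqP H]; rewrite ?eqxx //.
  by have := gv x; rewrite H eqxx.
by rewrite (negbTE H).
Qed.

(** * Weights supported on a clique *)

Definition part_weight {R : realType} n (r : nat) (a : nat -> nat) (w : 'I_n -> R) : R :=
  \sum_(s : {ffun 'I_r -> 'I_n} | injectiveb s) \prod_(i < r) w (s i) ^+ a i.

(** Non-adjacent vertices of one part cannot go to distinct vertices of the support, and the absence
    of loops keeps distinct parts apart. So the maps of nonzero weight are injections of the set of
    parts. *)
Lemma hom_weight_clique (R : realType) n r (a : nat -> nat) (G : graph n) (w : 'I_n -> R) :
  is_simple G -> (forall i, (i < r)%N -> (1 <= a i)%N) ->
  (forall u v, u != v -> w u != 0 -> w v != 0 -> G (u, v)) ->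
  hom_weight r a G w = part_weight r a w.
Proof.
move=> sG a0 clq; have irr := simple_irr sG.
pose nz (T : finType) (f : {ffun T -> 'I_n}) := [forall x, w (f x) != 0].
have zero (T : finType) (f : {ffun T -> 'I_n}) (b : T -> nat) :
    (forall x, (0 < b x)%N) -> ~~ nz _ f -> \prod_x w (f x) ^+ b x = 0.
  move=> b0 /forallPn[x]; rewrite negbK => /eqP fx.
  by rewrite (bigD1 x) //= fx expr0n; case: (b x) (b0 x) => // ? _; rewrite mul0r.
rewrite /hom_weight (bigID (nz _)) /= [X in _ + X]big1 ?addr0; last first.
  move=> f /andP[_ nf].
  by rewrite -(zero _ f (fun=> 1%N)).
rewrite /part_weight [in RHS](bigID (nz _)) /= [X in _ = _ + X]big1 ?addr0; last first.
  by move=> f /andP[_ nf]; apply: zero => // i; exact: a0.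
pose h (s : {ffun 'I_r -> 'I_n}) : {ffun Kpart_vert r a -> 'I_n} := [ffun x => s (tag x)].
pose v0 (i : 'I_r) : Kpart_vert r a := Tagged (fun i : 'I_r => 'I_(a i)) (Ordinal (a0 i (ltn_ord i))).
pose h' (f : {ffun Kpart_vert r a -> 'I_n}) := [ffun i => f (v0 i)].
rewrite (reindex_onto h h') /=; last first.
  move=> f /andP[/strongP fS /forallP nf]; apply/ffunP => x; rewrite !ffunE.
  apply/eqP; apply: contraT => fx.
  have := clq _ _ fx (nf _) (nf _); rewrite -fS /Kpart_edge.
  by rewrite eqxx.
apply: eq_big => [s|s _].
  have -> : h' (h s) == s by apply/eqP/ffunP => i; rewrite !ffunE.
  rewrite andbT; have -> : nz _ (h s) = nz _ s.
    apply/forallP/forallP => H x; last by rewrite ffunE.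
    by have := H (v0 x); rewrite ffunE.
  have [/forallP ns|] := boolP (nz _ s); rewrite ?andbF // !andbT.
  apply/strongP/injectiveP => [H i j ij|H x y].
    apply/eqP; have := H (v0 i) (v0 j); rewrite !ffunE ij irr /Kpart_edge /=.
    by move=> /negbFE.
  rewrite !ffunE /Kpart_edge; have [->|txy] := eqVneq (tag x) (tag y); first by rewrite irr.
  by rewrite clq // (inj_eq H).
under eq_bigr do rewrite ffunE.
rewrite -(@sig_big_dep _ _ _ _ (fun i : 'I_r => 'I_(a i)) xpredT (fun _ => xpredT)
  (fun i _ => w (s i))) /=.
by apply: eq_bigr => i _; rewrite prodr_const card_ord.
Qed.

Lemma part_monomial_set2 (R : realType) n r (a : nat -> nat) (w : 'I_n -> R) (u v : 'I_n)
    (x y : R) (s : {ffun 'I_r -> 'I_n}) : u != v ->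
  \prod_(i < r) set2 w u v x y (s i) ^+ a i =
    x ^+ (\sum_(i < r | s i == u) a i) * y ^+ (\sum_(i < r | s i == v) a i) *
    \prod_(i < r | (s i != u) && (s i != v)) w (s i) ^+ a i.
Proof.
move=> uv; rewrite (bigID (fun i => s i == u)) /= -mulrA !expr_sum; congr (_ * _).
  by apply: eq_bigr => i su; rewrite /set2 su.
rewrite (bigID (fun i => s i == v)) /=; congr (_ * _).
  apply: eq_big => i; first by case: (s i =P u) => //= ->; rewrite (negbTE uv).
  by move=> /andP[su sv]; rewrite /set2 (negbTE su) sv.
by apply: eq_bigr => i /andP[su sv]; rewrite /set2 (negbTE su) (negbTE sv).
Qed.

Lemma part_weight_set2C (R : realType) n r (a : nat -> nat) (w : 'I_n -> R) (u v : 'I_n)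
    (x y : R) : u != v ->
  part_weight r a (set2 w u v x y) = part_weight r a (set2 w u v y x).
Proof.
move=> uv; pose tau (s : {ffun 'I_r -> 'I_n}) := [ffun i => tperm u v (s i)].
have tauK : involutive tau by move=> f; apply/ffunP => i; rewrite !ffunE tpermK.
rewrite /part_weight (reindex_inj (inv_inj tauK)) /=.
apply: eq_big => [s|s _].
  apply/injectiveP/injectiveP => H i j; have := H i j; rewrite !ffunE.
    by move=> I E; apply: I; rewrite E.
  by move=> I /perm_inj.
apply: eq_bigr => i _; rewrite ffunE /set2; congr (_ ^+ _).
have vu : v == u = false by rewrite eq_sym (negbTE uv).
case: tpermP => [->|->|/eqP zu /eqP zv].
- by rewrite vu !eqxx.
- by rewrite vu !eqxx.
- by rewrite (negbTE zu) (negbTE zv).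
Qed.

(** [swap_chord] is applied monomial by monomial: an injective [s] sends at most one part to each of
    [u] and [v], so the exponents are 0 or part sizes, where balance applies. *)
Lemma part_weight_chord (R : realType) n r (a : nat -> nat) (w : 'I_n -> R) (u v : 'I_n)
    (h t : R) :
  (forall i j : 'I_r, ('C(maxn (a i) (a j) - minn (a i) (a j), 2) < minn (a i) (a j))%N) ->
  (forall i, 0 <= w i) -> u != v -> 0 <= h -> 0 <= t <= 1 ->
  w u = h * (1 + t) -> w v = h * (1 - t) ->
  part_weight r a w <= (1 - t ^+ 2) * part_weight r a (set2 w u v h h) +
    t ^+ 2 * part_weight r a (set2 w u v (2 * h) 0).
Proof.
move=> bal w0 uv h0 t01 wu wv.
have wE : w = set2 w u v (h * (1 + t)) (h * (1 - t)).
  apply/funext => i; rewrite /set2; case: eqP => [->|_] //; case: eqP => [->|_] //.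
pose p (s : {ffun 'I_r -> 'I_n}) := (\sum_(i < r | s i == u) a i)%N.
pose q (s : {ffun 'I_r -> 'I_n}) := (\sum_(i < r | s i == v) a i)%N.
pose rest (s : {ffun 'I_r -> 'I_n}) := \prod_(i < r | (s i != u) && (s i != v)) w (s i) ^+ a i.
(* Adding the swapped copy symmetrises each monomial into the shape bounded by [swap_chord]. *)
have twice x y : 2 * part_weight r a (set2 w u v x y) =
    \sum_(s : {ffun 'I_r -> 'I_n} | injectiveb s)
      (x ^+ p s * y ^+ q s + y ^+ p s * x ^+ q s) * rest s.
  rewrite mulr_natl mulr2n [X in _ + X]part_weight_set2C // -big_split /=.
  by apply: eq_bigr => s _; rewrite !part_monomial_set2 // -mulrDl.
rewrite -(ler_pM2l (ltr0Sn R 1)) [in leLHS]wE.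
rewrite [leLHS]twice [leRHS]mulrDr [X in _ <= X + _]mulrCA [X in _ <= _ + X]mulrCA !twice !mulr_sumr -big_split /=.
apply: ler_sum => s /injectiveP s_inj.
rewrite !mulrA -mulrDl ler_wpM2r //; first by apply: prodr_ge0 => i _; rewrite exprn_ge0.
have sumE z : (0 < \sum_(i < r | s i == z) a i)%N ->
    exists i : 'I_r, \sum_(i < r | s i == z) a i = a i.
  have [/existsP[i /eqP si] _|/existsPn H] := boolP [exists i, s i == z].
    by exists i; rewrite (big_pred1 i) // => j /=; rewrite -si (inj_eq s_inj).
  by rewrite big_pred0 // => i; exact/negbTE.
apply: swap_chord => // p0 q0.
by have [i pi] := sumE _ p0; have [j qj] := sumE _ q0; rewrite /p /q pi qj.
Qed.

Lemma part_weight_uniform (R : realType) n r (a : nat -> nat) (J : {set 'I_n}) (c : R) :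
  (forall i, (i < r)%N -> (1 <= a i)%N) ->
  part_weight r a (fun i => if i \in J then c else 0) = (#|J| ^_ r)%:R * c ^+ nverts r a.
Proof.
move=> a0.
rewrite /part_weight (bigID (fun s : {ffun 'I_r -> 'I_n} => s \in ffun_on (mem J))) /=.
rewrite [X in _ + X]big1 ?addr0; last first.
  move=> s /andP[_ /ffun_onP sJ].
  have /existsP[i si] : [exists i, s i \notin J].
    by apply: contraT => /existsPn H; case: sJ => i; have := H i; rewrite negbK.
  by rewrite (bigD1 i) //= (negbTE si) expr0n; case: (a i) (a0 i (ltn_ord i)) => // ? _; rewrite mul0r.
rewrite (eq_bigr (fun=> c ^+ nverts r a)) => [|s /andP[_ /ffun_onP sJ]]; last first.
  by rewrite /nverts expr_sum; apply: eq_bigr => i _; rewrite (sJ i).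
rewrite sumr_const mulr_natl; congr (_ *+ _).
rewrite -[in RHS](card_ord r) -card_inj_ffuns_on; apply: eq_card => s.
by rewrite inE andbC.
Qed.

(** * Maximizers on the simplex *)

Definition is_dist {R : realType} n (w : 'I_n -> R) := (forall i, 0 <= w i) /\ \sum_i w i = 1.

(** The simplex is compact and nonempty, and [hom_weight] is polynomial in the weights, hence
    continuous. *)
Lemma hom_weight_maximizer (R : realType) n r (a : nat -> nat) (G : graph n) : (0 < n)%N ->
  exists w : 'I_n -> R, is_dist w /\
    forall w', is_dist w' -> hom_weight r a G w' <= hom_weight r a G w.
Proof.
case: n G => // n G _.
pose A : set 'rV[R]_n.+1 := ([set v : 'rV[R]_n.+1 | forall i, `[0, 1]%classic (v ord0 i)] `&`
  (fun v : 'rV[R]_n.+1 => \sum_i v ord0 i)%R @^-1` [set 1%R])%classic.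
have coord i : continuous (fun v : 'rV[R]_n.+1 => v ord0 i) by exact: coord_continuous.
have cA : compact A.
  apply: compact_closedI.
    apply: (@rV_compact R n.+1 (fun=> `[0, 1]%classic)) => i.
    exact: segment_compact.
  apply: closed_comp; last exact: closed_eq.
  move=> v _; apply: (continuous_big (op := +%R)) => [|i _]; [exact: add_continuous|exact: coord].
have A0 : (A !=set0)%classic.
  exists (\row_i (if i == ord0 then 1 else 0)); split => /=.
    by move=> i; rewrite mxE in_itv /=; case: ifP; rewrite !lexx ler01.
  rewrite (bigD1 ord0) //= mxE eqxx big1 ?addr0 // => i /negbTE i0.
  by rewrite mxE i0.
pose f (v : 'rV[R]_n.+1) := hom_weight r a G (fun i => v ord0 i).
have fc : {within A, continuous f}%classic.
  apply: continuous_subspaceT; apply: (continuous_big (op := +%R)) => [|g _].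
    exact: add_continuous.
  apply: (@continuous_big R _ *%R 1) => [|x _]; [exact: mul_continuous|exact: coord].
have [c cA' fmax] := compact_EVT_max A0 cA fc.
move: cA'; rewrite inE => -[c01 c1].
exists (fun i => c ord0 i); split.
  by split=> // i; have := c01 i; rewrite /= in_itv /= => /andP[].
move=> w' [w0 w1].
have -> : w' = (fun i => (\row_i w' i) ord0 i) by apply/funext => i; rewrite mxE.
apply: fmax; rewrite inE; split => /= [i|].
  rewrite mxE in_itv /= w0 /= -w1 (bigD1 i) //= lerDl; exact: sumr_ge0.
by under eq_bigr do rewrite mxE.
Qed.

Lemma set2_dist (R : realType) n (w : 'I_n -> R) u v x y : is_dist w -> u != v ->
  0 <= x -> 0 <= y -> x + y = w u + w v -> is_dist (set2 w u v x y).
Proof.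
move=> [w0 w1] uv x0 y0 xy; split.
  by move=> i; rewrite /set2; case: ifP => // _; case: ifP.
have vu : v != u by rewrite eq_sym.
rewrite -w1 (bigD1 u) //= (bigD1 v) //= [in RHS](bigD1 u) //= [in RHS](bigD1 v) //= !addrA -xy.
rewrite /set2 !eqxx (negbTE vu); congr (_ + _).
by apply: eq_bigr => i /andP[/negbTE -> /negbTE ->].
Qed.

Definition wsupp {R : realType} n (w : 'I_n -> R) : {set 'I_n} := [set i | w i != 0].

Lemma wsupp_set2 (R : realType) n (w : 'I_n -> R) u v x y : u != v ->
  w u != 0 -> w v != 0 -> x = 0 \/ y = 0 -> (#|wsupp (set2 w u v x y)| < #|wsupp w|)%N.
Proof.
move=> uv wu wv xy; apply: proper_card; apply/properP; split.
  apply/fintype.subsetP => i; rewrite !inE /set2.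
  by case: (i =P u) => [->|_]; [rewrite wu|case: (i =P v) => [->|_] //; rewrite wv].
case: xy => ->; [exists u|exists v]; rewrite !inE ?wu ?wv // /set2 ?eqxx //.
by rewrite (eq_sym v) (negbTE uv) eqxx.
Qed.

(** Induction on the bound [N] for the support size: two non-adjacent vertices or two unequal
    weights in the support allow a merge that keeps the maximum and shrinks the support. What
    remains is uniform on a clique. *)
Lemma maximizer_le (R : realType) n r (a : nat -> nat) k (G : graph n) N (w : 'I_n -> R) :
  is_simple G -> ~~ has_clique G k.+1 ->
  (forall i, (i < r)%N -> (1 <= a i)%N) ->
  (forall i j : 'I_r, ('C(maxn (a i) (a j) - minn (a i) (a j), 2) < minn (a i) (a j))%N) ->
  is_dist w -> (forall w', is_dist w' -> hom_weight r a G w' <= hom_weight r a G w) ->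
  (#|wsupp w| <= N)%N ->
  exists2 j, (0 < j <= k)%N & hom_weight r a G w = (j ^_ r)%:R / j%:R ^+ nverts r a.
Proof.
move=> sG Gk a0 bal; elim: N w => [|N IH] w dw wmax wN.
  move: wN; rewrite leqn0 cards_eq0 => /eqP w0; case: dw => _ /esym/eqP.
  rewrite big1 ?oner_eq0 // => i _; apply/eqP/negPn.
  by have := finset.in_set0 i; rewrite -w0 inE => ->.
have [w0 w1] := dw.
(* A weight doing at least as well as [w] is itself a maximizer, so the induction hypothesis applies
   once its support is smaller. *)
have smaller w' : is_dist w' -> hom_weight r a G w <= hom_weight r a G w' ->
    (#|wsupp w'| < #|wsupp w|)%N ->
    exists2 j, (0 < j <= k)%N & hom_weight r a G w = (j ^_ r)%:R / j%:R ^+ nverts r a.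
  move=> dw' ww' lt.
  have eq : hom_weight r a G w = hom_weight r a G w' by apply/eqP; rewrite eq_le ww' wmax.
  have [|//|j j0 jE] := IH w' dw' _ _.
  - by move=> w2 dw2; rewrite -eq wmax.
  - by rewrite -ltnS (leq_trans lt).
  - by exists j; rewrite // eq.
have [clq|] := boolP [forall u, forall v, [==> u != v, w u != 0, w v != 0 => G (u, v)]]; last first.
  rewrite negb_forall => /existsP[u]; rewrite negb_forall => /existsP[v].
  rewrite !negb_imply => /and4P[uv wu wv Guv].
  have pu : 0 < w u by rewrite lt_def wu w0.
  have pv : 0 < w v by rewrite lt_def wv w0.
  have d1 : is_dist (set2 w u v (w u + w v) 0).
    by apply: set2_dist; rewrite ?addr_ge0 ?addr0.
  have d2 : is_dist (set2 w u v 0 (w u + w v)).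
    by apply: set2_dist; rewrite ?addr_ge0 ?add0r.
  have := nonadjacent_chord r a sG w0 uv Guv.
  have := ler_wpM2l (w0 v) (wmax _ d2).
  (* [h1] caps the second merge by the maximum; [h2] then makes the first merge at least as good as
     [w], after cancelling [w u]. *)
  rewrite mulrDl => h1 h2; apply: (smaller _ d1).
    by rewrite -(ler_pM2l pu); lra.
  by apply: wsupp_set2 => //; right.
have {}clq u v : u != v -> w u != 0 -> w v != 0 -> G (u, v).
  move=> uv wu wv; move/forallP: clq => /(_ u)/forallP/(_ v).
  by rewrite uv wu wv.
have clq2 u v x y : u != v -> w u != 0 -> w v != 0 ->
    hom_weight r a G (set2 w u v x y) = part_weight r a (set2 w u v x y).
  move=> uv wu wv; apply: hom_weight_clique => // i j ij.
  have nz l : set2 w u v x y l != 0 -> w l != 0.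
    by rewrite /set2; case: (l =P u) => [->|_] //; case: (l =P v) => [->|_].
  by move=> /nz wi /nz wj; exact: clq.
have [/existsP[u /existsP[v /andP[wv wuv]]]|] := boolP [exists u, exists v, (w v != 0) && (w v < w u)].
  have pv : 0 < w v by rewrite lt_def wv w0.
  have pu := lt_trans pv wuv.
  have wu : w u != 0 by rewrite gt_eqF.
  have uv : u != v by apply: contraTneq wuv => ->; rewrite ltxx.
  (* The mean of the two weights and their relative gap. Once the averaged term is bounded by the
     maximum, [t > 0] allows division by t^2. *)
  pose h := (w u + w v) / 2; pose t := (w u - w v) / (w u + w v).
  have s0 : 0 < w u + w v by rewrite addr_gt0.
  have t0 : 0 < t by rewrite divr_gt0 // subr_gt0.
  have t1 : t < 1 by rewrite ltr_pdivrMr // mul1r; lra.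
  have h0 : 0 <= h by rewrite divr_ge0 // ltW.
  have wuE : w u = h * (1 + t) by rewrite /h /t; field; rewrite gt_eqF.
  have wvE : w v = h * (1 - t) by rewrite /h /t; field; rewrite gt_eqF.
  have t01 : 0 <= t <= 1 by rewrite !ltW.
  have h2 : 2 * h = w u + w v by rewrite /h; field.
  have da : is_dist (set2 w u v h h) by apply: set2_dist => //; rewrite -h2; lra.
  have dm : is_dist (set2 w u v (2 * h) 0).
    by apply: set2_dist => //; rewrite ?addr0 // mulr_ge0.
  have := part_weight_chord bal w0 uv h0 t01 wuE wvE.
  rewrite -(hom_weight_clique sG a0 clq) -!clq2 // => H.
  have tt : 0 <= 1 - t ^+ 2 by nra.
  have H1 := ler_wpM2l tt (wmax _ da).
  apply: (smaller _ dm); last by apply: wsupp_set2 => //; right.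
  by rewrite -(ler_pM2l (exprn_gt0 2 t0)); lra.
move=> /existsPn flat.
have {}flat u v : w v != 0 -> w u <= w v.
  move=> wv; have := flat u; rewrite negb_exists => /forallP/(_ v).
  by rewrite wv /= -leNgt.
have [v0 wv0] : exists v, w v != 0.
  apply/existsP; apply: contraT => /existsPn z; have := oner_neq0 R.
  by rewrite -w1 big1 ?eqxx // => i _; apply/eqP/negPn/z.
have wE : w = (fun i => if i \in wsupp w then w v0 else 0).
  apply/funext => i; rewrite inE; case: eqP => //= /eqP wi.
  by apply/eqP; rewrite eq_le !flat.
have supp_gt0 : (0 < #|wsupp w|)%N by apply/card_gt0P; exists v0; rewrite inE.
have cE : w v0 = #|wsupp w|%:R^-1.
  have S0 : #|wsupp w|%:R != 0 :> R by rewrite pnatr_eq0 -lt0n.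
  apply: (mulIf S0); rewrite mulVf // mulr_natr -sumr_const -[RHS]w1.
  rewrite [RHS](bigID (mem (wsupp w))) /= [X in _ + X]big1 ?addr0; last first.
    by move=> i; rewrite inE negbK => /eqP.
  apply: eq_bigr => i iJ; have := congr1 (fun f => f i) wE; rewrite /= => ->.
  by rewrite iJ.
exists #|wsupp w|.
  rewrite supp_gt0 leqNgt; apply: contra Gk => lt.
  have : (0 < 'C(#|wsupp w|, k.+1))%N by rewrite bin_gt0.
  rewrite -cards_draws => /card_gt0P[C]; rewrite inE => /andP[/fintype.subsetP sub Ck].
  apply/existsP; exists C; rewrite Ck; apply/forall_inP => i iC; apply/forall_inP => j jC.
  by apply/implyP => ij; apply: clq => //; [have := sub _ iC|have := sub _ jC]; rewrite inE.
by rewrite hom_weight_clique // {1}wE part_weight_uniform // cE exprVn.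
Qed.

Lemma hom_weight_le (R : realType) n r (a : nat -> nat) k (G : graph n) (w : 'I_n -> R) :
  is_simple G -> ~~ has_clique G k.+1 ->
  (forall i, (i < r)%N -> (1 <= a i)%N) ->
  (forall i j : 'I_r, ('C(maxn (a i) (a j) - minn (a i) (a j), 2) < minn (a i) (a j))%N) ->
  is_dist w ->
  exists2 j, (0 < j <= k)%N & hom_weight r a G w <= (j ^_ r)%:R / j%:R ^+ nverts r a.
Proof.
move=> sG Gk a0 bal dw.
have n0 : (0 < n)%N.
  case: n w G sG Gk dw => // w ? ? ? [_ /esym/eqP]; by rewrite big_ord0 oner_eq0.
have [w' [dw' wmax]] := @hom_weight_maximizer R n r a G n0.
have [j jk jE] := maximizer_le sG Gk a0 bal dw' wmax (leqnn _).
by exists j => //; rewrite -jE wmax.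
Qed.

(** * Unimodality of the density of Turan graphs *)

Lemma fvalE (R : realType) (r ell j : nat) : (0 < r)%N -> (0 < ell)%N -> (0 < j)%N ->
  fval r ell j = (j ^_ r)%:R / j%:R ^+ ell :> R.
Proof.
case: r ell j => [//|r] [//|ell] [//|j] _ _ _; rewrite /fval /= ffactnS exprS natrM natrX.
have : j.+1%:R != 0 :> R by rewrite pnatr_eq0.
by move: (j.+1%:R : R) => x x0; field; rewrite expf_neq0.
Qed.

(** The ratio of consecutive values is n / (n - r + 1) times (n / (n + 1))^(ell - 1). One more
    factor n / (n + 1) turns its comparison with 1 into a condition on 1 / (n + 1) alone. *)
Lemma fval_succ (R : realType) (r ell n : nat) : (0 < r <= n)%N -> (0 < ell)%N ->
  (fval r ell n <= fval r ell n.+1 :> R) =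
    (1 - r%:R * n.+1%:R^-1 <= (1 - n.+1%:R^-1) ^+ ell :> R).
Proof.
case: r ell n => [//|r] [//|ell] [//|n] /= rn _.
rewrite /fval /= !natrX.
have A0 : (0 : R) < (n ^_ r)%:R by rewrite ltr0n ffact_gt0.
have B0 : (0 : R) < (n.+1 ^_ r)%:R by rewrite ltr0n ffact_gt0 ltnW.
have AB : (n.+1 ^_ r)%:R * (n.+1 - r)%:R = n.+1%:R * (n ^_ r)%:R :> R.
  by rewrite -!natrM -ffactnSr ffactnS.
have d0 : (0 : R) < (n.+1 - r)%:R by rewrite ltr0n subn_gt0.
have x0 : (0 : R) < n.+1%:R by [].
have y0 : (0 : R) < n.+2%:R by [].
have yn := lt0r_neq0 y0.
have e0 : (0 : R) < n.+1%:R ^+ ell by rewrite exprn_gt0.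
have f0 : (0 : R) < n.+2%:R ^+ ell by rewrite exprn_gt0.
have -> : (1 - n.+2%:R^-1) ^+ ell.+1 = n.+1%:R ^+ ell.+1 / n.+2%:R ^+ ell.+1 :> R.
  rewrite -expr_div_n; congr (_ ^+ _).
  by apply: (mulIf yn); rewrite mulfVK // mulrBl mulVf // mul1r -(natr1 n.+1) addrK.
have -> : 1 - r.+1%:R / n.+2%:R = (n.+1 - r)%:R / n.+2%:R :> R.
  rewrite natrB; last by rewrite ltnW.
  apply: (mulIf yn); rewrite mulfVK // mulrBl mulfVK // mul1r -(natr1 n.+1) -(natr1 r).
  lra.
rewrite !exprS ler_pdivrMr // mulrAC ler_pdivlMr // ler_pdivrMr //.
rewrite [X in _ = (_ <= X)]mulrAC ler_pdivlMr ?mulr_gt0 //.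
rewrite -(ler_pM2l d0).
have -> : (n.+1 - r)%:R * ((n.+1 ^_ r)%:R * n.+1%:R ^+ ell) =
    (n ^_ r)%:R * (n.+1%:R * n.+1%:R ^+ ell) :> R.
  by rewrite mulrA (mulrC (n.+1 - r)%:R) AB; ring.
rewrite (mulrCA _ (n ^_ r)%:R) (ler_pM2l A0).
rewrite (mulrCA _ n.+2%:R) [X in _ = (_ <= X)]mulrC (ler_pM2l y0).
by [].
Qed.

(* The condition of [fval_succ] reads [g 0 <= g (1 / n.+1)] for the convex function
   [g y = (1 - y) ^ ell + r y], so it is inherited by smaller [n]. *)
Lemma fval_succ_down (R : realType) (r ell n n' : nat) : (0 < r <= n')%N -> (0 < ell)%N ->
  (n' <= n)%N ->
  fval r ell n <= fval r ell n.+1 :> R -> fval r ell n' <= fval r ell n'.+1 :> R.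
Proof.
move=> /andP[r0 rn'] l0 nn'; rewrite !fval_succ ?r0 ?rn' ?(leq_trans rn') //.
set y := n.+1%:R^-1; set y' := n'.+1%:R^-1.
have y0 : 0 < y by rewrite invr_gt0.
have y'0 : 0 < y' by rewrite invr_gt0.
have y'1 : y' <= 1 by rewrite invf_le1 // ler1n.
have yy' : y <= y' by rewrite lef_pV2 ?posrE // ler_nat.
pose l := y / y'.
have lp : 0 < l by rewrite divr_gt0.
have l01 : 0 <= l <= 1 by rewrite ltW //= ler_pdivrMr // mul1r.
have z01 : 0 <= 1 - y' <= 1 by apply/andP; split; lra.
have := expr_chord ell l01 z01.
have -> : 1 - l + l * (1 - y') = 1 - y by rewrite /l; field; rewrite gt_eqF.
have -> : y = l * y' by rewrite /l; field; rewrite gt_eqF.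
move=> h1 h2; have := le_trans h2 h1; rewrite -[_ <= (1 - y') ^+ ell](ler_pM2l lp); lra.
Qed.

(** The step from [m.-1] to [m] is an increase because [m] is the maximizer; [fval_succ_down]
    carries this to every earlier step. *)
Lemma fval_nondecreasing (R : realType) (r ell m j k : nat) : (0 < r)%N -> (0 < ell)%N ->
  (forall i, (r <= i)%N -> i <> m -> fval r ell i < fval r ell m :> R) ->
  (r <= j <= k)%N -> (k <= m)%N -> fval r ell j <= fval r ell k :> R.
Proof.
move=> r0 l0 mmax /andP[rj]; elim: k => [|k IH]; first by rewrite leqn0 => /eqP ->.
rewrite leq_eqVlt => /orP[/eqP -> //|jk km].
have rk : (r <= k)%N by rewrite (leq_trans rj).
apply: le_trans (IH jk (ltnW km)) _.
have m0 : (0 < m)%N by apply: leq_trans km.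
apply: (@fval_succ_down R r ell m.-1 k); rewrite ?r0 //; first by rewrite -ltnS prednK.
rewrite prednK //; apply/ltW/mmax; first by rewrite (leq_trans rk) // -ltnS prednK.
by move=> E; move: m0; rewrite -E; case: (m) E => // i /= /n_Sn.
Qed.

(** * Embeddings and automorphisms *)

Definition embeddings n r (a : nat -> nat) (G : graph n) :
    {set {ffun Kpart_vert r a -> 'I_n}} :=
  [set f : {ffun Kpart_vert r a -> 'I_n} | injectiveb f && strong G f].

Definition Kpart_aut r (a : nat -> nat) : {set {perm Kpart_vert r a}} :=
  [set s : {perm Kpart_vert r a} | [forall x, forall y, Kpart_edge (s x) (s y) == Kpart_edge x y]].

Lemma Kpart_autP r (a : nat -> nat) (s : {perm Kpart_vert r a}) :
  reflect (forall x y, Kpart_edge (s x) (s y) = Kpart_edge x y) (s \in Kpart_aut r a).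
Proof.
rewrite inE; apply: (iffP forallP) => [H x y|H x]; first by move/forallP: (H x) => /(_ y)/eqP.
by apply/forallP => y; apply/eqP/H.
Qed.

(** The embeddings with image [S] are a fixed one, [f0], precomposed with the automorphisms of F, so
    every copy has equally many. *)
Lemma card_embeddings n r (a : nat -> nat) (G : graph n) :
  #|embeddings r a G| = (Icount r a G * #|Kpart_aut r a|)%N.
Proof.
pose im (f : {ffun Kpart_vert r a -> 'I_n}) : {set 'I_n} := [set f x | x : Kpart_vert r a].
rewrite -sum1_card (partition_big im (fun S => induced_copy r a G S)) /=; last first.
  move=> f; rewrite inE => /andP[fi fS]; apply/existsP; exists f; apply/and3P; split => //.
rewrite /Icount -sum_nat_const; apply: eq_big => S; first by rewrite inE.
move=> /existsP[f0 /and3P[/injectiveP f0i /eqP SE f0S]].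
have f0P := strongP _ _ f0S.
pose c (s : {perm Kpart_vert r a}) := [ffun x => f0 (s x)].
have c_inj : injective c.
  move=> s1 s2 /ffunP E; apply/permP => x; have := E x; rewrite !ffunE; exact: f0i.
rewrite sum1_card -(card_imset _ c_inj); apply: eq_card => f; rewrite unfold_in.
apply/andP/imsetP => [[]|[s /Kpart_autP sA ->]].
  rewrite inE => /andP[/injectiveP fi /strongP fS] /eqP fim.
  have ex x : exists y, f0 y == f x.
    have : f x \in S by rewrite -fim; apply/imsetP; exists x.
    by rewrite SE => /imsetP[y _ ->]; exists y.
  pose g x := xchoose (ex x).
  have gE x : f0 (g x) = f x by apply/eqP; exact: (xchooseP (ex x)).
  have gi : injective g by move=> x y E; apply: fi; rewrite -!gE E.
  exists (perm gi); last by apply/ffunP => x; rewrite ffunE permE gE.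
  by apply/Kpart_autP => x y; rewrite !permE f0P !gE -fS.
split.
  rewrite inE; apply/andP; split.
    by apply/injectiveP => x y; rewrite !ffunE => /f0i/perm_inj.
  by apply/strongP => x y; rewrite !ffunE -f0P sA.
rewrite SE; apply/eqP/setP => z; apply/imsetP/imsetP => -[x _ ->].
  by exists (s x); rewrite ?ffunE.
by exists ((s^-1)%g x); rewrite // ffunE permKV.
Qed.

(** The bound on the moved points lets the count go by induction on the list of labels. *)
Definition label_perms (T : finType) (I : eqType) (f : T -> I) (vs : seq I) : {set {perm T}} :=
  [set s : {perm T} | [forall x, f (s x) == f x] && perm_on [set x | f x \in vs] s].

(** For a new label [v], a permutation splits uniquely into an arbitrary permutation of the class of
    [v] and one counted for the tail, which fixes that class. *)
Lemma card_label_perms (T : finType) (I : eqType) (f : T -> I) (vs : seq I) : uniq vs ->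
  #|label_perms f vs| = (\prod_(v <- vs) (#|[set x | f x == v]|)`!)%N.
Proof.
elim: vs => [_|v vs IH /= /andP[vvs uvs]].
  rewrite big_nil (_ : label_perms f [::] = [set 1%g]) ?cards1 //.
  apply/setP => s; rewrite !inE; apply/andP/eqP => [[_ /fintype.subsetP sP]|->].
    apply/permP => x; rewrite perm1; apply/eqP; apply: contraT => sx.
    by have := sP x; rewrite !inE sx => /(_ isT).
  by split; [apply/forallP => x; rewrite perm1|exact: perm_on1].
rewrite big_cons -IH // -card_perm -[#|perm_on _|]cardsE; set A := [set x | f x == v].
pose h (p : {perm T} * {perm T}) := (p.1 * p.2)%g.
have fixA (s : {perm T}) x : s \in label_perms f vs -> x \in A -> s x = x.
  rewrite !inE => /andP[_ sP] /eqP fx; apply: (out_perm sP).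
  by rewrite inE fx.
have h_inj : {in finset.setX [set s in perm_on A] (label_perms f vs) &, injective h}.
  move=> [s1 s2] [t1 t2]; rewrite !finset.in_setX /h /=.
  move=> /andP[s1A s2B] /andP[t1A t2B] E; move: s1A t1A; rewrite !finset.in_set => s1A t1A.
  have st1 : s1 = t1.
    apply/permP => x; have [xA|xA] := boolP (x \in A); last by rewrite !(out_perm _ xA).
    have := congr1 (fun s : {perm T} => s x) E; rewrite !permM /=.
    have s1x : s1 x \in A by rewrite perm_closed.
    have t1x : t1 x \in A by rewrite perm_closed.
    by rewrite (fixA s2) // (fixA t2).
  by move: E; rewrite st1 => /mulgI ->.
rewrite -cardsX -(card_in_imset h_inj); apply: eq_card => s.
apply/idP/imsetP => [|[[s1 s2]]].
  rewrite inE => /andP[/forallP sf sP].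
  have sN : s \in 'N(A | 'P)%g.
    rewrite !inE /=; apply/fintype.subsetP => x; rewrite !inE => /eqP fx.
    by rewrite /aperm (eqP (sf x)) fx.
  set s1 := restr_perm A s; have s1A : perm_on A s1 by exact: restr_perm_on.
  exists (s1, (s1^-1 * s)%g); last by rewrite /h mulKVg.
  have E x : (s1^-1 * s)%g x = if x \in A then x else s x.
    rewrite permM; case: ifP => [xA|/negbT xA].
      have s1x : (s1^-1)%g x \in A by rewrite perm_closed // perm_onV.
      by rewrite -(restr_permE sN s1x) permKV.
    by rewrite (out_perm (perm_onV s1A) xA).
  rewrite finset.in_setX finset.in_set; apply/andP; split; first exact: s1A.
  rewrite inE; apply/andP; split.
    by apply/forallP => x; rewrite E; case: ifP.
  apply/fintype.subsetP => x; rewrite !inE E; case: ifP; first by rewrite eqxx.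
  move=> xA sx; have := fintype.subsetP sP x; rewrite !inE sx => /(_ isT).
  by move: xA; rewrite inE => ->.
rewrite finset.in_setX /= => /andP[s1A]; rewrite [_ \in label_perms _ _]inE.
rewrite finset.in_set in s1A; move=> /andP[/forallP s2f s2P] ->; rewrite inE /h /=; apply/andP; split.
  apply/forallP => x; rewrite permM (eqP (s2f _)).
  have [xA|xA] := boolP (x \in A); last by rewrite (out_perm s1A).
  have : s1 x \in A by rewrite perm_closed.
  by move: xA; rewrite !inE => /eqP -> .
apply/fintype.subsetP => x; rewrite !inE permM; apply: contraR.
rewrite negb_or => /andP[fxv fxvs].
have xA : x \notin A by rewrite inE.
by rewrite (out_perm s1A xA) (out_perm s2P) // inE.
Qed.

Lemma card_part r (a : nat -> nat) (i : 'I_r) :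
  #|[set x : Kpart_vert r a | tag x == i]| = a i.
Proof.
have inj : injective (fun z : 'I_(a i) => Tagged (fun i : 'I_r => 'I_(a i)) z).
  by move=> z z' E; apply/val_inj; exact: (congr1 (fun x : Kpart_vert r a => val (tagged x)) E).
rewrite -[RHS]card_ord -(card_imset _ inj).
apply: eq_card => x; rewrite inE; apply/eqP/imsetP => [<-|[z _ ->] //].
by exists (tagged x) => //; case: x.
Qed.

(** In this form the symmetry factor counts the size-preserving permutations of the parts, the image
    of the automorphism group. *)
Lemma symfE r (a : nat -> nat) :
  symf r a = #|label_perms (fun i : 'I_r => a i) (undup [seq a i | i <- iota 0 r])|.
Proof.
rewrite card_label_perms ?undup_uniq //; apply: eq_bigr => v _; congr (_`!)%N.
rewrite -val_enum_ord count_map cardE [in RHS]/enum_mem size_filter enumT.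
by apply: eq_count => i; rewrite /= inE.
Qed.

(** Lying in one part means being non-adjacent, so an automorphism induces a size-preserving
    permutation of the parts. All of these lift, and the kernel is the product of the symmetric
    groups of the parts. *)
Lemma card_Kpart_aut r (a : nat -> nat) : (forall i, (i < r)%N -> (1 <= a i)%N) ->
  #|Kpart_aut r a| = ((\prod_(i < r) (a i)`!) * symf r a)%N.
Proof.
move=> a0; pose V := Kpart_vert r a.
pose v0 (i : 'I_r) : V := Tagged (fun i : 'I_r => 'I_(a i)) (Ordinal (a0 i (ltn_ord i))).
pose Ker := label_perms (fun x : V => tag x) (enum 'I_r).
pose Stab := label_perms (fun i : 'I_r => a i) (undup [seq a i | i <- iota 0 r]).
have KerE k : (k \in Ker) = [forall x, tag (k x) == tag x].
  rewrite inE; case: [forall _, _] => //=; apply/fintype.subsetP => x _.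
  by rewrite inE mem_enum.
have StabE s : (s \in Stab) = [forall i, a (s i) == a i].
  rewrite inE; case: [forall _, _] => //=; apply/fintype.subsetP => x _.
  rewrite inE mem_undup; apply/mapP; exists (val x) => //.
  by rewrite mem_iota add0n /=.
have -> : (\prod_(i < r) (a i)`!)%N = #|Ker|.
  rewrite card_label_perms ?enum_uniq // big_enum /=.
  by apply: eq_bigr => i _; rewrite card_part.
rewrite symfE -/Stab mulnC.
pose lifts (s : {perm 'I_r}) (c : {perm V}) := [forall x, tag (c x) == s (tag x)].
have lift_ex s : s \in Stab -> exists c, lifts s c.
  rewrite StabE => /forallP sa.
  pose g (x : V) : V := Tagged (fun i : 'I_r => 'I_(a i))
    (cast_ord (esym (eqP (sa (tag x)))) (tagged x)).
  have gi : injective g.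
    move=> [i x] [j y] E.
    have ij : i = j by apply: (@perm_inj _ s); exact: (congr1 (@tag _ _) E).
    move: x y E; rewrite -ij => x y E; congr (Tagged _ _).
    by apply/val_inj; exact: (congr1 (fun z : V => val (tagged z)) E).
  by exists (perm gi); apply/forallP => x; rewrite permE.
(* A chosen lift of [s]. One exists on [Stab], so the default [1] is never taken there. *)
pose lft s := odflt 1%g [pick c | lifts s c].
have lftP s : s \in Stab -> forall x, tag (lft s x) = s (tag x).
  move=> /lift_ex[c cs] x; rewrite /lft; case: pickP => [c' /forallP/(_ x)/eqP //|/(_ c)].
  by rewrite cs.
pose h (p : {perm 'I_r} * {perm V}) := (p.2 * lft p.1)%g.
have h_tag p x : p \in finset.setX Stab Ker -> tag (h p x) = p.1 (tag x).
  case: p => s k; rewrite finset.in_setX /= => /andP[sS]; rewrite KerE => /forallP kK.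
  by rewrite /h permM lftP //= (eqP (kK x)).
have h_inj : {in finset.setX Stab Ker &, injective h}.
  move=> [s k] [s' k'] H H' E.
  have ss : s = s'.
    apply/permP => i; have := h_tag _ (v0 i) H; rewrite E (h_tag _ _ H') /=.
    by move=> ->.
  by move: E; rewrite /h ss /= => /mulIg ->.
rewrite -cardsX -(card_in_imset h_inj); apply: eq_card => c.
apply/Kpart_autP/imsetP => [cA|[p pP -> x y]]; last first.
  by rewrite /Kpart_edge !h_tag // (inj_eq perm_inj).
have tagE x y : (tag (c x) == tag (c y)) = (tag x == tag y).
  by apply: negb_inj; exact: cA.
pose p i := tag (c (v0 i)).
have p_inj : injective p by move=> i j /eqP; rewrite /p tagE => /eqP.
have pE x : tag (c x) = p (tag x) by apply/eqP; rewrite tagE.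
pose s := perm p_inj.
have sS : s \in Stab.
  rewrite StabE; apply/forallP => i; rewrite permE -(card_part a (p i)) -[X in _ == X](card_part a i).
  rewrite -[X in _ == X](card_imset _ (@perm_inj _ c)); apply/eqP; apply: eq_card => y; rewrite inE.
  apply/eqP/imsetP => [yi|[x]]; last by rewrite inE => /eqP <- ->.
  exists ((c^-1)%g y); last by rewrite permKV.
  by rewrite inE -(inj_eq p_inj) -pE permKV yi.
exists (s, (c * (lft s)^-1)%g); last by rewrite /h /= mulgKV.
rewrite finset.in_setX sS /= KerE; apply/forallP => x; rewrite permM.
by rewrite -(inj_eq (@perm_inj _ s)) -lftP // permKV permE pE.
Qed.

(** * Bounds at finite order *)

Lemma card_Kpart r (a : nat -> nat) : #|{: Kpart_vert r a}| = nverts r a.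
Proof.
rewrite -sum1_card /nverts.
rewrite -(@sig_big_dep _ _ _ _ (fun i : 'I_r => 'I_(a i)) xpredT (fun _ => xpredT)
  (fun i _ => 1%N)) /=.
by apply: eq_bigr => i _; rewrite sum1_card card_ord.
Qed.

(** At the uniform weight 1 / n each strong homomorphism counts n^(-l), and the embeddings are among
    them. *)
Lemma Imax_le (R : realType) r (a : nat -> nat) k n (M : R) :
  (0 < n)%N -> (0 < r)%N -> (0 < nverts r a)%N -> 0 <= M ->
  (forall i, (i < r)%N -> (1 <= a i)%N) ->
  (forall i j : 'I_r, ('C(maxn (a i) (a j) - minn (a i) (a j), 2) < minn (a i) (a j))%N) ->
  (forall j, (0 < j <= k)%N -> fval r (nverts r a) j <= M) ->
  (Imax r a k n * #|Kpart_aut r a|)%:R <= n%:R ^+ nverts r a * M.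
Proof.
move=> n0 r0 l0 M0 a0 bal MP.
have nR : (0 : R) < n%:R by rewrite ltr0n.
rewrite /Imax; elim/big_ind: _ => [|x y Px Py|G /andP[sG Gk]].
- by rewrite mul0n mulr_ge0 // exprn_ge0 // ltW.
- by rewrite /maxn; case: ifP.
rewrite -card_embeddings.
pose w : 'I_n -> R := fun=> n%:R^-1.
have dw : is_dist w.
  split=> [i|]; first by rewrite invr_ge0 ltW.
  by rewrite sumr_const card_ord -[_ *+ _]mulr_natl mulfV // gt_eqF.
have [j /[dup] jk /andP[j0 _]] := hom_weight_le sG Gk a0 bal dw.
rewrite -fvalE // => H; have {H} := le_trans H (MP j jk).
rewrite /hom_weight (eq_bigr (fun=> n%:R^-1 ^+ nverts r a)) => [|f _]; last first.
  by rewrite prodr_const card_Kpart.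
rewrite sumr_const -[_ *+ _]mulr_natl exprVn ler_pdivrMr ?exprn_gt0 // mulrC.
apply: le_trans; rewrite ler_nat; apply: subset_leq_card.
by apply/fintype.subsetP => f; rewrite inE => /andP[].
Qed.

(** * Turan graphs on residue classes, and the lower bound *)

Definition mod_graph n (j : nat) : graph n := [ffun p : 'I_n * 'I_n => p.1 %% j != p.2 %% j]%N.

Lemma mod_graph_simple n j : is_simple (mod_graph n j).
Proof.
apply/andP; split; apply/forallP => x; first by rewrite ffunE eqxx.
by apply/forallP => y; rewrite !ffunE (eq_sym (x %% j)%N).
Qed.

Lemma mod_graph_clique n j k : (0 < j <= k)%N -> ~~ has_clique (mod_graph n j) k.+1.
Proof.
move=> /andP[j0 jk]; apply/existsPn => C; apply/negP => /andP[/eqP Ck /forall_inP clq].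
pose h (x : 'I_n) : 'I_j := Ordinal (ltn_pmod x j0).
have h_inj : {in C &, injective h}.
  move=> x y xC yC E; apply/eqP; apply: contraT => xy.
  have /forall_inP/(_ y yC) := clq x xC; rewrite xy ffunE /=.
  by rewrite (congr1 val E : x %% j = y %% j)%N eqxx.
have := max_card (mem (h @: C)); rewrite card_in_imset // Ck card_ord.
by rewrite ltnNge jk.
Qed.

(** An injection of the parts into the [j] classes gives the residues, and the quotients below
    [n %/ j] are free at every vertex of F. *)
Lemma strong_mod_graph_ge r (a : nat -> nat) n j : (0 < j)%N ->
  (forall i, (i < r)%N -> (1 <= a i)%N) ->
  (j ^_ r * (n %/ j) ^ nverts r a <= #|[set f | @strong n r a (mod_graph n j) f]|)%N.
Proof.
move=> j0 a0; pose V := Kpart_vert r a.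
pose v0 (i : 'I_r) : V := Tagged (fun i : 'I_r => 'I_(a i)) (Ordinal (a0 i (ltn_ord i))).
have lt (g : {ffun V -> 'I_(n %/ j)}) (s : {ffun 'I_r -> 'I_j}) x :
    (g x * j + s (tag x) < n)%N.
  apply: (@leq_trans ((g x).+1 * j)); first by rewrite mulSn addnC ltn_add2r.
  by apply: leq_trans (leq_divM n j); rewrite leq_mul2r ltn_ord orbT.
pose h (p : {ffun 'I_r -> 'I_j} * {ffun V -> 'I_(n %/ j)}) : {ffun V -> 'I_n} :=
  [ffun x => Ordinal (lt p.2 p.1 x)].
have hmod p x : (h p x %% j = p.1 (tag x))%N by rewrite ffunE /= modnMDl modn_small.
have hdiv p x : (h p x %/ j = p.2 x)%N.
  by rewrite ffunE /= divnMDl // [X in (_ + X)%N]divn_small ?addn0.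
have h_inj : injective h.
  move=> [s g] [s' g'] E; congr pair; apply/ffunP => x; apply/val_inj.
    by have := hmod (s, g) (v0 x); rewrite E hmod.
  by have := hdiv (s, g) x; rewrite E hdiv.
have -> : (j ^_ r * (n %/ j) ^ nverts r a =
    #|finset.setX [set s : {ffun 'I_r -> 'I_j} | injectiveb s] [set: {ffun V -> 'I_(n %/ j)}]|)%N.
  by rewrite cardsX cardsT card_ffun card_inj_ffuns !card_ord card_Kpart.
rewrite -(card_imset _ h_inj); apply: subset_leq_card; apply/fintype.subsetP => f.
move=> /imsetP[p]; rewrite [p]surjective_pairing finset.in_setX inE => /andP[/injectiveP p_inj _] ->.
rewrite inE; apply/strongP => x y; rewrite [RHS]ffunE /= !hmod /Kpart_edge.
by rewrite (inj_eq val_inj) (inj_eq p_inj).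
Qed.

(* Non-injective maps are discarded wholesale: there are [n ^ l - n ^_ l] of them. *)
Lemma Imax_ge r (a : nat -> nat) k n j : (0 < j <= k)%N ->
  (forall i, (i < r)%N -> (1 <= a i)%N) ->
  (j ^_ r * (n %/ j) ^ nverts r a + n ^_ nverts r a <=
    Imax r a k n * #|Kpart_aut r a| + n ^ nverts r a)%N.
Proof.
move=> jk a0; have /andP[j0 _] := jk.
pose S := [set f | @strong n r a (mod_graph n j) f].
pose I := [set f : {ffun Kpart_vert r a -> 'I_n} | injectiveb f].
have cI : #|I| = (n ^_ nverts r a)%N by rewrite card_inj_ffuns card_ord card_Kpart.
apply: (@leq_trans (#|S| + #|I|)); first by rewrite cI leq_add2r strong_mod_graph_ge.
(* The intersection of [S] and [I] consists of the embeddings, and the union has at most n^l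
   elements. *)
rewrite -cardsUI addnC leq_add //.
  apply: (@leq_trans #|embeddings r a (mod_graph n j)|).
    by apply: subset_leq_card; apply/fintype.subsetP => f; rewrite !inE andbC.
  rewrite card_embeddings leq_mul2r; apply/orP; right.
  by rewrite /Imax leq_bigmax_cond // mod_graph_simple mod_graph_clique.
by apply: leq_trans (max_card _) _; rewrite card_ffun card_ord card_Kpart.
Qed.

(** * Limits *)

Local Open Scope classical_set_scope.
Local Open Scope ring_scope.

Lemma cvg_inv_natr (R : realType) : (n%:R^-1 : R) @[n --> \oo] --> 0.
Proof.
apply/gtr0_cvgV0; last exact: cvgr_idn.
by exists 1%N => // n /= n0; rewrite ltr0n.
Qed.

Lemma cvg_ffact_ratio (R : realType) (l : nat) :
  ((n ^_ l)%:R / n%:R ^+ l : R) @[n --> \oo] --> (1 : R).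
Proof.
elim: l => [|l IH].
  by apply: cvg_near_cst; near=> n; rewrite ffactn0 expr0 divr1.
rewrite -[X in _ --> X]mulr1.
have H : (1 - l%:R * n%:R^-1 : R) @[n --> \oo] --> (1 : R).
  rewrite -[X in _ --> X]subr0; apply: cvgB; first exact: cvg_cst.
  by rewrite -(mulr0 l%:R); apply: cvgM; [exact: cvg_cst|exact: cvg_inv_natr].
apply: cvg_trans (cvgM IH H); apply: near_eq_cvg; near=> n => /=.
have n0 : (n%:R : R) != 0 by rewrite pnatr_eq0 -lt0n; near: n; exists 1%N.
rewrite ffactnSr natrM natrB; last by near: n; exists l.
by rewrite exprSr; field; rewrite n0 expf_neq0.
Unshelve. all: end_near. Qed.

Lemma cvg_divn_ratio (R : realType) (j : nat) : (0 < j)%N ->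
  ((n %/ j)%:R / n%:R : R) @[n --> \oo] --> (j%:R^-1 : R).
Proof.
move=> j0; have jR : (0 : R) < j%:R by rewrite ltr0n.
have L : (j%:R^-1 - n%:R^-1 : R) @[n --> \oo] --> (j%:R^-1 : R).
  by rewrite -[X in _ --> X]subr0; apply: cvgB; [exact: cvg_cst|exact: cvg_inv_natr].
apply: squeeze_cvgr L (cvg_cst _); near=> n.
have n0 : (0 : R) < n%:R by rewrite ltr0n; near: n; exists 1%N.
have nE : n%:R = (n %/ j)%:R * j%:R + (n %% j)%:R :> R by rewrite -natrM -natrD -divn_eq.
have mj : (n %% j)%:R <= j%:R :> R by rewrite ler_nat ltnW // ltn_pmod.
rewrite ler_pdivlMr // mulrBl mulVf ?gt_eqF // ler_pdivrMr //.
have -> : j%:R^-1 * n%:R = (n %/ j)%:R + (n %% j)%:R / j%:R :> R.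
  by rewrite nE mulrDr mulrCA mulVf ?gt_eqF // mulr1 (mulrC j%:R^-1).
have : 0 <= (n %% j)%:R / j%:R :> R by rewrite divr_ge0.
have : (n %% j)%:R / j%:R <= 1 :> R by rewrite ler_pdivrMr // mul1r.
by move=> ? ?; apply/andP; split; lra.
Unshelve. all: end_near. Qed.

(** The largest and the smallest part form the worst pair, with the widest gap and the least
    minimum, and the binomial is monotone. *)
Lemma almost_balanced_pair r (a : nat -> nat) :
  (forall i j, (i <= j < r)%N -> (a j <= a i)%N) -> almost_balanced r a ->
  forall i j : 'I_r, ('C(maxn (a i) (a j) - minn (a i) (a j), 2) < minn (a i) (a j))%N.
Proof.
move=> mono /andP[_ bal] i j.
have r0 : (0 < r)%N by case: r i {mono bal j} => // -[].
have hi (l : 'I_r) : (a l <= a 0%N)%N by apply: mono; rewrite leq0n ltn_ord.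
have lo (l : 'I_r) : (a r.-1 <= a l)%N by apply: mono; rewrite -ltnS prednK // ltn_ord leqnn.
apply: (@leq_ltn_trans 'C(a 0%N - a r.-1, 2)).
  by apply: leq_bin2l; apply: leq_sub; rewrite ?geq_max ?leq_min ?hi ?lo.
by apply: leq_trans bal _; rewrite leq_min !lo.
Qed.

Unset Implicit Arguments.
Set Strict Implicit.

Theorem theorem1p3 (R : realType) (r : nat) (a : nat -> nat) (m k : nat) :
  (2 <= r)%N ->
  (forall i j, (i <= j < r)%N -> (a j <= a i)%N) ->
  (forall i, (i < r)%N -> (1 <= a i)%N) ->
  (r.+1 <= nverts r a)%N ->
  almost_balanced r a ->
  (* m = m_{r,ell}: the unique maximizer of f over integers >= r *)
  (r <= m)%N ->
  (forall j, (r <= j)%N -> j <> m -> fval r (nverts r a) j < fval r (nverts r a) m :> R) ->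
  (r <= k)%N ->
  (fun n => ((Imax r a k n)%:R / ('C(n, nverts r a))%:R : R)) @ \oo -->
    (if (k < m)%N then kappa r a * fval r (nverts r a) k
     else kappa r a * fval r (nverts r a) m : R).
Proof.
move=> r2 mono a0 rl ab rm mmax rk.
have bal := almost_balanced_pair mono ab.
have r0 : (0 < r)%N by rewrite ltnW.
have l0 : (0 < nverts r a)%N by rewrite (leq_ltn_trans _ rl).
set l := nverts r a in rl l0 mmax *.
(* The minimum of [k] and [m]: the number of classes of the best Turan graph allowed. *)
pose j := if (k < m)%N then k else m.
have rj : (r <= j)%N by rewrite /j; case: ifP.
have jk : (0 < j <= k)%N.
  by rewrite (leq_trans r0 rj) /= /j; case: (ltnP k m) => // _; rewrite leqnn.
have /andP[j0 _] := jk.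
have -> : (if (k < m)%N then kappa r a * fval r l k else kappa r a * fval r l m : R) =
    kappa r a * fval r l j by rewrite /j; case: ifP.
have M0 : 0 <= fval r l j :> R by rewrite divr_ge0.
have MP i : (0 < i <= k)%N -> fval r l i <= fval r l j :> R.
  (* Below [r] the density is 0; if [k < m] it is nondecreasing from [r] to [k]; if [m <= k] then
     [j] is the global maximizer. *)
  move=> /andP[i0 ik]; have [ir|ri] := ltnP i r.
    apply: le_trans M0; rewrite /fval ffact_small ?mul0r //.
    by rewrite -ltnS !prednK.
  rewrite /j; case: ifP => [km|_].
    by apply: (fval_nondecreasing r0 l0 mmax); rewrite ?ri // ltnW.
  by have [->//|/eqP im] := eqVneq i m; apply/ltW/mmax.
have K0 : 0 <= kappa r a :> R by rewrite divr_ge0.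
have A0 : (0 < #|Kpart_aut r a|)%N.
  apply/card_gt0P; exists 1%g; apply/Kpart_autP => x y; by rewrite !perm1.
(* [kappa] is l! over the number of automorphisms and C(n, l) l! is the falling factorial, so the
   ratio becomes embeddings over [n ^_ l]. *)
have bound n : (l <= n)%N ->
    (Imax r a k n)%:R / 'C(n, l)%:R =
    kappa r a * ((Imax r a k n * #|Kpart_aut r a|)%:R / (n ^_ l)%:R) :> R.
  move=> ln; rewrite /kappa -card_Kpart_aut // -bin_ffact !natrM -/l.
  have A0R : (#|Kpart_aut r a|)%:R != 0 :> R by rewrite pnatr_eq0 -lt0n.
  have f0 : (l`!)%:R != 0 :> R by rewrite pnatr_eq0 -lt0n fact_gt0.
  have b0 : ('C(n, l))%:R != 0 :> R by rewrite pnatr_eq0 -lt0n bin_gt0.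
  by field; rewrite A0R f0 b0.
pose rho n : R := ((n ^_ l)%:R / n%:R ^+ l)^-1.
have rho1 : rho n @[n --> \oo] --> (1 : R).
  by rewrite -[X in _ --> X]invr1; apply: cvgV; [exact: oner_neq0|exact: cvg_ffact_ratio].
pose U n : R := kappa r a * (fval r l j * rho n).
(* [rho n] changes the normalisation from n^l to [n ^_ l]; the part [1 - rho n] accounts for the
   discarded non-injective maps. *)
pose L n : R := kappa r a * ((j ^_ r)%:R * ((n %/ j)%:R / n%:R) ^+ l * rho n + 1 - rho n).
apply: (@squeeze_cvgr _ _ _ _ L U).
- near=> n.
  have ln : (l <= n)%N by near: n; exists l.
  have n0 : (0 < n)%N by apply: leq_trans l0 ln.
  have f0 : (0 : R) < (n ^_ l)%:R by rewrite ltr0n ffact_gt0.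
  have e0 : (0 : R) < n%:R ^+ l by rewrite exprn_gt0 // ltr0n.
  rewrite bound // /L /U; apply/andP; split; apply: ler_wpM2l => //.
    rewrite ler_pdivlMr // /rho invf_div mulrBl mulrDl expr_div_n -(mulrA _ (n%:R ^+ l / _)).
    rewrite divfK ?gt_eqF // -mulrA divfK ?gt_eqF // mul1r lerBlDr.
    by rewrite -!natrX -natrM -!natrD ler_nat Imax_ge.
  rewrite ler_pdivrMr // /rho invf_div -mulrA divfK ?gt_eqF // mulrC.
  exact: Imax_le.
- rewrite /L; apply: cvgM; first exact: cvg_cst.
  rewrite fvalE // -[X in _ --> X](addrK 1) ; apply: cvgB => //; apply: cvgD; last exact: cvg_cst.
  rewrite -[X in _ --> X]mulr1; apply: cvgM => //; apply: cvgM; first exact: cvg_cst.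
  rewrite -exprVn.
  elim: (l) => [|i IH]; first by under eq_cvg do rewrite expr0; rewrite expr0; exact: cvg_cst.
  under eq_cvg do rewrite exprS.
  by rewrite exprS; apply: cvgM => //; exact: cvg_divn_ratio.
- rewrite /U; apply: cvgM; first exact: cvg_cst.
  by rewrite -[X in _ --> X]mulr1; apply: cvgM => //; exact: cvg_cst.
Unshelve. all: end_near. Qed.
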